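(* Let $\Gamma\subset\mathbb{R}^d$ be a free $\mathcal{S}$-module of rank $d$ that spans $\mathbb{R}^d$. If $d=p$ is a prime number, then $\operatorname{OS}(\Gamma)/\operatorname{OC}(\Gamma)$ is an elementary Abelian $p$-group, i.e., it is the direct sum of cyclic groups of order $p$.
   Context: $\mathcal{S}\subset\mathbb{R}$ is a ring with unity (a subring of $\mathbb{R}$ containing $1$) that is also a finitely generated $\mathbb{Z}$-module. A free $\mathcal{S}$-module $\Gamma\subset\mathbb{R}^d$ of rank $d$ that spans $\mathbb{R}^d$ is the $\mathcal{S}$-span of an $\mathbb{R}$-basis of $\mathbb{R}^d$; it is a free $\mathbb{Z}$-module of finite rank. Two free $\mathbb{Z}$-modules $M,M'\subset\mathbb{R}^d$ of finite rank are commensurate, written $M\sim M'$, if $M\cap M'$ has finite index both in $M$ and in $M'$. $\operatorname{OC}(\Gamma)=\{R\in\operatorname{O}(d,\mathbb{R}):R\Gamma\sim\Gamma\}$ and $\operatorname{OS}(\Gamma)=\{R\in\operatorname{O}(d,\mathbb{R}):\alpha R\Gamma\sim\Gamma\text{ for some real }\alpha>0\}$. These are subgroups of $\operatorname{O}(d,\mathbb{R})$, and $\operatorname{OC}(\Gamma)$ is a normal subgroup of $\operatorname{OS}(\Gamma)$. Direct sums may have infinitely many (or no) summands. *)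

(* Defs.v *)
From HB Require Import structures.
From mathcomp Require Import all_boot all_order all_algebra.
From mathcomp Require Import all_classical reals.

Set Implicit Arguments.
Unset Strict Implicit.
Unset Printing Implicit Defensive.

Import Order.TTheory GRing.Theory Num.Theory.
Local Open Scope classical_set_scope.
Local Open Scope ring_scope.

Section Commensurability.
Variable V : zmodType.
Implicit Types M N P : set V.

(* The set of cosets x + N with x in M is finite; meant for subgroups N <= M. *)
Definition finite_index N M : Prop :=
  finite_set [set [set x + y | y in N] | x in M].

Definition commensurate M N : Prop :=
  finite_index (M `&` N) M /\ finite_index (M `&` N) N.

Definition is_subgroup M : Prop := M 0 /\ forall x y, M x -> M y -> M (x - y).

Lemma is_subgroupN M x : is_subgroup M -> M x -> M (- x).
Proof. by case=> M0 MB Mx; rewrite -sub0r; apply: MB. Qed.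

Lemma is_subgroupD M x y : is_subgroup M -> M x -> M y -> M (x + y).
Proof. by move=> sM Mx My; rewrite -[y]opprK; apply: sM.2 => //; apply: is_subgroupN. Qed.

Lemma is_subgroupI M N : is_subgroup M -> is_subgroup N -> is_subgroup (M `&` N).
Proof.
move=> [M0 MB] [N0 NB]; split=> // x y [Mx Nx] [My Ny].
by split; [apply: MB | apply: NB].
Qed.

Lemma is_subgroup_zmodClosed (S : zmodClosed V) : is_subgroup [set` S].
Proof. by split=> [|x y] /=; [apply: rpred0 | apply: rpredB]. Qed.

Lemma finite_indexP N M : is_subgroup N ->
  finite_index N M <->
  exists s : seq V, forall x, M x -> exists2 y, y \in s & N (x - y).
Proof.
move=> sN; split.
  move/finite_seqP => [ss ssE].
  exists (map (fun C : set V => xget 0 C) ss) => x Mx.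
  set C : set V := [set x + y | y in N].
  have Css : C \in ss.
    have : [set [set x + y | y in N] | x in M] C by exists x.
    by rewrite ssE.
  have : C (xget 0 C) by apply: (@xgetI _ _ _ x); exists 0; [exact: sN.1 | rewrite addr0].
  move=> [n Nn nE]; exists (xget 0 C); first exact: (map_f _ Css).
  by rewrite -nE opprD addNKr; apply: is_subgroupN.
move=> [s sP]; apply: (@sub_finite_set _ _ [set` map (fun x => [set x + y | y in N]) s]);
  last exact: finite_seq.
move=> C [x Mx <-] /=; have [y ys Nxy] := sP _ Mx.
apply/mapP; exists y => //; apply/seteqP; split=> z [n Nn <-].
  by exists ((x - y) + n); [apply: is_subgroupD | rewrite addrA [y + _]addrC subrK].
exists (n - (x - y)); first exact: sN.2.
by rewrite opprB addrCA [x + _]addrC subrK addrC.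
Qed.

Lemma commensurate_refl M : is_subgroup M -> commensurate M M.
Proof.
move=> sM; suff h : finite_index (M `&` M) M by [].
rewrite setIid; apply/finite_indexP => //; exists [:: 0] => x Mx.
by exists 0; rewrite ?mem_head ?subr0.
Qed.

Lemma commensurate_sym M N : commensurate M N -> commensurate N M.
Proof. by move=> [h1 h2]; rewrite /commensurate setIC. Qed.

Lemma finite_index_trans M N P :
    is_subgroup M -> is_subgroup N -> is_subgroup P ->
  finite_index (M `&` N) M -> finite_index (N `&` P) N -> finite_index (M `&` P) M.
Proof.
move=> sM sN sP /finite_indexP-/(_ (is_subgroupI sM sN)) [s1 s1P].
move=> /finite_indexP-/(_ (is_subgroupI sN sP)) [s2 s2P].
apply/finite_indexP; first exact: is_subgroupI.
pose Z y : set V := [set z | (M `&` N) z /\ (N `&` P) (z - y)].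
exists [seq y1 + xget 0 (Z y) | y1 <- s1, y <- s2] => x Mx.
have [y1 y1s [Mxy Nxy]] := s1P _ Mx.
have [y ys NPy] := s2P _ Nxy.
exists (y1 + xget 0 (Z y)); first by apply/allpairsP; exists (y1, y).
have [[Mz Nz] NPz] : Z y (xget 0 (Z y)) by apply: (@xgetI _ _ _ (x - y1)).
rewrite opprD addrA; split; first exact: sM.2.
have [_] := (is_subgroupI sN sP).2 _ _ NPy NPz.
by rewrite opprB addrA subrK.
Qed.

Lemma commensurate_trans M N P :
    is_subgroup M -> is_subgroup N -> is_subgroup P ->
  commensurate M N -> commensurate N P -> commensurate M P.
Proof.
move=> sM sN sP [mn nm] [np pn]; split; first exact: (finite_index_trans sM sN sP).
rewrite setIC; apply: (finite_index_trans sP sN sM); by rewrite setIC.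
Qed.

End Commensurability.

Section LinearImage.
Variables (R : comUnitRingType) (d : nat).
Implicit Types (A B : 'M[R]_d) (M N : set 'cV[R]_d).

Definition mximage A M : set 'cV[R]_d := [set A *m v | v in M].

Lemma mximage1 M : mximage 1%:M M = M.
Proof.
apply/seteqP; split=> [_ [v Mv <-]|v Mv]; first by rewrite mul1mx.
by exists v; rewrite ?mul1mx.
Qed.

Lemma mximageM A B M : mximage (A *m B) M = mximage A (mximage B M).
Proof.
apply/seteqP; split=> [_ [v Mv <-]|_ [_ [v Mv <-] <-]].
  by exists (B *m v); [exists v | rewrite mulmxA].
by exists v; rewrite ?mulmxA.
Qed.

Lemma is_subgroup_mximage A M : is_subgroup M -> is_subgroup (mximage A M).
Proof.
move=> [M0 MB]; split; first by exists 0; rewrite ?mulmx0.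
by move=> _ _ [v Mv <-] [w Mw <-]; exists (v - w); [apply: MB | rewrite mulmxBr].
Qed.

Lemma commensurate_mximage A M N : A \in unitmx ->
    is_subgroup M -> is_subgroup N ->
  commensurate M N -> commensurate (mximage A M) (mximage A N).
Proof.
move=> uA sM sN [h1 h2].
have AI : mximage A M `&` mximage A N = mximage A (M `&` N).
  apply/seteqP; split=> [_ [[v Mv <-] [w Nw]]|_ [v [Mv Nv] <-]].
    move=> /(congr1 (mulmx (invmx A))); rewrite !mulKmx // => wv.
    by exists v => //; split=> //; rewrite -wv.
  by split; exists v.
have idx K : finite_index (M `&` N) K -> finite_index (mximage A (M `&` N)) (mximage A K).
  move=> /finite_indexP-/(_ (is_subgroupI sM sN)) [s sP].
  apply/finite_indexP; first exact/is_subgroup_mximage/is_subgroupI.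
  exists (map (mulmx A) s) => _ [v Kv <-]; have [y ys My] := sP _ Kv.
  by exists (A *m y); [apply: map_f | exists (v - y); rewrite ?mulmxBr].
by rewrite /commensurate AI; split; apply: idx.
Qed.

End LinearImage.

Section OrthogonalGroup.
Variables (R : comUnitRingType) (d : nat).

Definition orthogonalmx : qualifier 0 'M[R]_d :=
  [qualify A : 'M[R]_d | A^T *m A == 1%:M].

Definition orthogonal_group : Type := {A : 'M[R]_d | A \is orthogonalmx}.
HB.instance Definition _ := Choice.on orthogonal_group.
HB.instance Definition _ := SubType.on orthogonal_group.

Lemma orthogonalmxP (A : 'M[R]_d) :
  reflect (A^T *m A = 1%:M) (A \is orthogonalmx).
Proof. exact: eqP. Qed.

Lemma orthogonalmx1 : (1%:M : 'M[R]_d) \is orthogonalmx.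
Proof. by apply/orthogonalmxP; rewrite trmx1 mulmx1. Qed.

Lemma orthogonalmxM (A B : 'M[R]_d) :
  A \is orthogonalmx -> B \is orthogonalmx -> A *m B \is orthogonalmx.
Proof.
move=> /orthogonalmxP oA /orthogonalmxP oB; apply/orthogonalmxP.
by rewrite trmx_mul mulmxA -(mulmxA B^T) oA mulmx1.
Qed.

Lemma orthogonalmxV (A : 'M[R]_d) : A \is orthogonalmx -> A^T \is orthogonalmx.
Proof. by move=> /orthogonalmxP oA; apply/orthogonalmxP; rewrite trmxK mulmx1C. Qed.

Lemma orthogonalmx_unit (A : 'M[R]_d) : A \is orthogonalmx -> A \in unitmx.
Proof. by move=> /orthogonalmxP /mulmx1_unit[]. Qed.

Implicit Types A B C : orthogonal_group.

Definition orth_one : orthogonal_group := exist _ 1%:M orthogonalmx1.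
Definition orth_mul A B : orthogonal_group :=
  exist _ (val A *m val B) (orthogonalmxM (valP A) (valP B)).
Definition orth_inv A : orthogonal_group := exist _ (val A)^T (orthogonalmxV (valP A)).

Fact orth_mulA : associative orth_mul.
Proof. by move=> A B C; apply: val_inj; apply: mulmxA. Qed.
Fact orth_mul1 : left_id orth_one orth_mul.
Proof. by move=> A; apply: val_inj; apply: mul1mx. Qed.
Fact orth_1mul : right_id orth_one orth_mul.
Proof. by move=> A; apply: val_inj; apply: mulmx1. Qed.
Fact orth_mulV : left_inverse orth_one orth_inv orth_mul.
Proof. by move=> A; apply: val_inj; apply/orthogonalmxP/valP. Qed.
Fact orth_Vmul : right_inverse orth_one orth_inv orth_mul.
Proof. by move=> A; apply: val_inj; apply/mulmx1C/orthogonalmxP/valP. Qed.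

HB.instance Definition _ := isGroup.Build orthogonal_group
  orth_mulA orth_mul1 orth_1mul orth_mulV orth_Vmul.

End OrthogonalGroup.

Section Quotient.
Variable G : groupType.
Local Open Scope group_scope.

Record normal_subgroup := NormalSubgroup {
  normal_pred :> {pred G};
  normal1 : 1 \in normal_pred;
  normalM : forall x y, x \in normal_pred -> y \in normal_pred -> x * y \in normal_pred;
  normalV : forall x, x \in normal_pred -> x^-1 \in normal_pred;
  normalJ : forall x y, x \in normal_pred -> x ^ y \in normal_pred }.

Variable N : normal_subgroup.

Definition coset_rel : rel G := fun x y => x^-1 * y \in N.

Fact coset_rel_refl : reflexive coset_rel.
Proof. by move=> x; rewrite /coset_rel mulVg normal1. Qed.
Fact coset_rel_sym : symmetric coset_rel.
Proof.
suff h x y : coset_rel x y -> coset_rel y x by move=> x y; apply/idP/idP; apply: h.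
by move=> /normalV; rewrite invgM invgK.
Qed.
Fact coset_rel_trans : transitive coset_rel.
Proof. by move=> y x z xy /(normalM xy); rewrite mulgA mulgK. Qed.

Canonical coset_equiv :=
  EquivRel coset_rel coset_rel_refl coset_rel_sym coset_rel_trans.

Definition quotient_group : Type := {eq_quot coset_equiv}%qT.
HB.instance Definition _ := Choice.on quotient_group.
HB.instance Definition _ := EqQuotient.on quotient_group.

Definition quot_pi (x : G) : quotient_group := (\pi_(quotient_group) x)%qT.

Lemma quot_piP x y : reflect (quot_pi x = quot_pi y) (x^-1 * y \in N).
Proof. by apply: (iffP idP) => [h|/eqmodP //]; apply/eqmodP. Qed.

Definition quot_one : quotient_group := quot_pi 1.
Definition quot_mul (a b : quotient_group) : quotient_group := quot_pi (repr a * repr b).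
Definition quot_inv (a : quotient_group) : quotient_group := quot_pi (repr a)^-1.

Lemma quot_reprK (a : quotient_group) : quot_pi (repr a) = a.
Proof. exact: reprK. Qed.

Lemma quot_mul_pi x y : quot_mul (quot_pi x) (quot_pi y) = quot_pi (x * y).
Proof.
have /quot_piP hx := quot_reprK (quot_pi x).
have /quot_piP hy := quot_reprK (quot_pi y).
apply/quot_piP; set x' := repr _ in hx *; set y' := repr _ in hy *.
have -> : (x' * y')^-1 * (x * y) = (x'^-1 * x) ^ y' * (y'^-1 * y).
  by rewrite invgM conjgE !mulgA mulgK.
by apply: normalM => //; apply: normalJ.
Qed.

Lemma quot_inv_pi x : quot_inv (quot_pi x) = quot_pi x^-1.
Proof.
have /quot_piP hx := quot_reprK (quot_pi x).
apply/quot_piP; set x' := repr _ in hx *.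
have -> : x'^-1^-1 * x^-1 = ((x'^-1 * x) ^ x'^-1)^-1.
  by rewrite conjgE !invgK !mulgA mulgV mul1g invgM invgK.
by apply: normalV; apply: normalJ.
Qed.

Fact quot_mulA : associative quot_mul.
Proof.
move=> a b c; rewrite -(quot_reprK a) -(quot_reprK b) -(quot_reprK c).
by rewrite !quot_mul_pi mulgA.
Qed.
Fact quot_mul1 : left_id quot_one quot_mul.
Proof. by move=> a; rewrite -(quot_reprK a) quot_mul_pi mul1g. Qed.
Fact quot_1mul : right_id quot_one quot_mul.
Proof. by move=> a; rewrite -(quot_reprK a) quot_mul_pi mulg1. Qed.
Fact quot_mulV : left_inverse quot_one quot_inv quot_mul.
Proof. by move=> a; rewrite -(quot_reprK a) quot_inv_pi quot_mul_pi mulVg. Qed.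
Fact quot_Vmul : right_inverse quot_one quot_inv quot_mul.
Proof. by move=> a; rewrite -(quot_reprK a) quot_inv_pi quot_mul_pi mulgV. Qed.

HB.instance Definition _ := isGroup.Build quotient_group
  quot_mulA quot_mul1 quot_1mul quot_mulV quot_Vmul.

Lemma quot_piM x y : quot_pi (x * y) = quot_pi x * quot_pi y.
Proof. by rewrite -quot_mul_pi. Qed.

End Quotient.

Section CoincidenceGroups.
Variables (R : realType) (d : nat).
(* Commensurability is transitive only on subgroups, so Gamma is an additive
   subgroup; every S-module in R^d is one. *)
Variable Gamma : zmodClosed 'cV[R]_d.
Implicit Types A B : orthogonal_group R d.

Definition OC : {pred orthogonal_group R d} :=
  [pred A | `[< commensurate (mximage (val A) [set` Gamma]) [set` Gamma] >]].

Definition OS : {pred orthogonal_group R d} :=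
  [pred A | `[< exists2 alpha : R, 0 < alpha &
    commensurate (mximage (alpha *: val A) [set` Gamma]) [set` Gamma] >]].

Let sG : is_subgroup [set` Gamma] := is_subgroup_zmodClosed Gamma.
Let sI (B : 'M[R]_d) := is_subgroup_mximage B sG.

Lemma OCP A :
  reflect (commensurate (mximage (val A) [set` Gamma]) [set` Gamma]) (A \in OC).
Proof. exact: asboolP. Qed.

Lemma OSP A :
  reflect (exists2 alpha : R, 0 < alpha &
    commensurate (mximage (alpha *: val A) [set` Gamma]) [set` Gamma]) (A \in OS).
Proof. exact: asboolP. Qed.

Lemma OC_sub_OS A : A \in OC -> A \in OS.
Proof. by move=> /OCP h; apply/OSP; exists 1 => //; rewrite scale1r. Qed.

Let scale_unit (a : R) A : 0 < a -> a *: val A \in unitmx.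
Proof.
move=> a0; rewrite unitmxZ ?unitfE ?gt_eqF //.
exact: orthogonalmx_unit (valP A).
Qed.

Let comm_mul (B C : 'M[R]_d) : B \in unitmx ->
  commensurate (mximage B [set` Gamma]) [set` Gamma] ->
  commensurate (mximage C [set` Gamma]) [set` Gamma] ->
  commensurate (mximage (B *m C) [set` Gamma]) [set` Gamma].
Proof.
move=> uB hB hC; apply: (commensurate_trans _ (sI B) _ _ hB) => //.
rewrite mximageM; exact: commensurate_mximage.
Qed.

Let comm_inv (B C : 'M[R]_d) : C \in unitmx -> C *m B = 1%:M ->
  commensurate (mximage B [set` Gamma]) [set` Gamma] ->
  commensurate (mximage C [set` Gamma]) [set` Gamma].
Proof.
move=> uC CB hB; apply: commensurate_sym.
by rewrite -{1}(mximage1 [set` Gamma]) -CB mximageM; apply: commensurate_mximage.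
Qed.

Lemma OS_group_closed : group_closed OS.
Proof.
have OS1 : 1%g \in OS.
  apply/OSP; exists 1 => //; rewrite scale1r /= mximage1.
  exact: commensurate_refl.
split=> // A B /OSP[a a0 hA] /OSP[b b0 hB].
have hBV : commensurate (mximage (b^-1 *: val (B^-1)%g) [set` Gamma]) [set` Gamma].
  apply: comm_inv hB; first by apply: scale_unit; rewrite invr_gt0.
  rewrite -scalemxAl -scalemxAr scalerA mulVf ?gt_eqF // scale1r.
  exact/orthogonalmxP/valP.
apply/OSP; exists (a * b^-1); first by rewrite mulr_gt0 ?invr_gt0.
have := comm_mul (scale_unit A a0) hA hBV.
by rewrite -scalemxAl -scalemxAr scalerA.
Qed.

Definition OS_group : Type := {A : orthogonal_group R d | A \in OS}.
HB.instance Definition _ := SubType.on OS_group.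
HB.instance Definition _ := Choice.on OS_group.
HB.instance Definition _ :=
  SubChoice_isSubGroup.Build (orthogonal_group R d) (mem OS) OS_group OS_group_closed.

Definition OC_in_OS : {pred OS_group} := [pred A | val A \in OC].

Let unitO A : val A \in unitmx := orthogonalmx_unit (valP A).

Fact OC_in_OS1 : 1%g \in OC_in_OS.
Proof.
apply/OCP; rewrite /= mximage1; exact: commensurate_refl.
Qed.

Fact OC_in_OSM (A B : OS_group) :
  A \in OC_in_OS -> B \in OC_in_OS -> (A * B)%g \in OC_in_OS.
Proof. by move=> /OCP hA /OCP hB; apply/OCP; apply: comm_mul. Qed.

Fact OC_in_OSV (A : OS_group) : A \in OC_in_OS -> (A^-1)%g \in OC_in_OS.
Proof.
move=> /OCP hA; apply/OCP; apply: comm_inv hA => //.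
exact/orthogonalmxP/(valP (val A)).
Qed.

Fact OC_in_OSJ (A B : OS_group) : A \in OC_in_OS -> (A ^ B)%g \in OC_in_OS.
Proof.
move=> /OCP hA; apply/OCP; have /OSP[b b0 hB] := valP B.
have u : b^-1 *: (val (val B))^T \in unitmx.
  by apply: (scale_unit (val B)^-1%g); rewrite invr_gt0.
have hBV : commensurate (mximage (b^-1 *: (val (val B))^T) [set` Gamma]) [set` Gamma].
  apply: comm_inv hB; first exact: u.
  rewrite -scalemxAl -scalemxAr scalerA mulVf ?gt_eqF // scale1r.
  exact/orthogonalmxP/valP.
have := comm_mul u hBV (comm_mul (unitO (val A)) hA hB).
by rewrite -scalemxAr -!scalemxAr -scalemxAl scalerA mulfV ?gt_eqF // scale1r.
Qed.

Definition OC_normal : normal_subgroup OS_group :=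
  NormalSubgroup OC_in_OS1 OC_in_OSM OC_in_OSV OC_in_OSJ.

Definition OS_mod_OC : groupType := quotient_group OC_normal.

End CoincidenceGroups.

Section Hypotheses.
Variable R : realType.

Definition finitely_generated_Zmodule (S : {pred R}) : Prop :=
  exists n (s : n.-tuple R), forall x, x \in S <-> inIntSpan s x.

Definition spanning_free_module (S : {pred R}) d (Gamma : {pred 'cV[R]_d}) : Prop :=
  exists2 b : d.-tuple 'cV[R]_d, basis_of fullv b &
    forall v, v \in Gamma <->
      exists2 c : 'I_d -> R, (forall i, c i \in S) & v = \sum_(i < d) c i *: b`_i.

End Hypotheses.

(* G is isomorphic to a direct sum, over an arbitrary index type, of copies of
   the cyclic group of order p: the families of elements of 'Z_p with finite
   support. Primality excludes p = 0, 1, for which 'Z_p has two elements. *)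
Definition elementary_abelian (p : nat) (G : groupType) : Prop :=
  prime p /\
  exists (I : Type) (f : G -> I -> 'Z_p),
    [/\ injective f,
        forall x y i, f (x * y)%g i = f x i + f y i &
        range f = [set u | finite_set [set i | u i != 0]]].

(* Main.v *)
Require Import Defs.
From HB Require Import structures.
From mathcomp Require Import all_boot all_order all_algebra.
From mathcomp Require Import all_classical reals.

Set Implicit Arguments.
Unset Strict Implicit.
Unset Printing Implicit Defensive.

Import Order.TTheory GRing.Theory Num.Theory.
Local Open Scope classical_set_scope.
Local Open Scope ring_scope.

(** If [a *: A] maps [Gamma] to a commensurate module, call [a] a similarity
ratio of [A].  Ratios multiply, and [A] lies in [OC Gamma] exactly when 1 is a
ratio of [A].  Hence, for [A] and [B] in [OS Gamma] with ratios [a] and [b], the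
commutator of [A] and [B] has ratio [a^-1 * b^-1 * a * b = 1], so the quotient is
Abelian ([ratioM], [ratioV]).

For the exponent, let [a] be a ratio of [A].  In a basis of [Gamma] over [S],
the matrix of [a *: A] has entries in [S] up to a common integer denominator,
because the index of commensurability bounds the denominators
([finite_index_exponent]).  Its determinant [+- a ^+ d] then has a positive
integer multiple in [S] ([det_commensurate]), and the same holds for the inverse
matrix.  A scalar [c] such that [c] and [c^-1] both have such multiples maps
[Gamma] to a commensurate module, [Gamma] being finitely generated over the
integers ([scalar_commensurate]).  So [a ^+ d] is a ratio of the identity
([ratio_exp_dim]) as well as of [A ^+ d] ([ratioX]), whence 1 is a ratio of
[A ^+ d].

With [d = p] prime, the quotient is thus Abelian of exponent dividing [p], in
other words a vector space over ['F_p].  A basis of it, given by Zorn's lemma,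
yields the decomposition into cyclic groups of order [p]: the coordinates
identify the space with the finitely supported families indexed by the basis
([exists_basis], [exists_coordinates]). *)

(** * Bases of vector spaces of arbitrary dimension *)

Section Basis.
Variables (F : fieldType) (V : lmodType F).
Implicit Types (B : set V) (c : V -> F) (x : V).

Definition fsupp c : set V := [set v | c v != 0].

Definition lincomb c : V := \sum_(v \in [set: V]) c v *: v.

Lemma lincombE (s : seq V) c : uniq s -> fsupp c `<=` [set` s] ->
  lincomb c = \sum_(v <- s) c v *: v.
Proof.
move=> us cs; rewrite /lincomb (fsbigE s) //.
  by apply: eq_bigl => v; rewrite in_setT.
move=> v _ vs; have [->|/cs /=] := eqVneq (c v) 0; first by rewrite scale0r.
by rewrite (negPf vs).
Qed.

Lemma finite_fsuppP c : finite_set (fsupp c) ->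
  exists2 s : seq V, uniq s & fsupp c `<=` [set` s].
Proof.
move=> /finite_seqP [s ->]; exists (undup s); first exact: undup_uniq.
by move=> v /=; rewrite mem_undup.
Qed.

Lemma fsuppD a c c' : fsupp (fun v => a * c v + c' v) `<=` fsupp c `|` fsupp c'.
Proof.
move=> v; rewrite /fsupp /=; have [->|] := eqVneq (c v) 0; last by left.
by rewrite mulr0 add0r; right.
Qed.

Lemma finite_fsuppD a c c' : finite_set (fsupp c) -> finite_set (fsupp c') ->
  finite_set (fsupp (fun v => a * c v + c' v)).
Proof.
by move=> fc fc'; apply: (sub_finite_set (@fsuppD a c c')); rewrite finite_setU.
Qed.

Lemma lincombD a c c' : finite_set (fsupp c) -> finite_set (fsupp c') ->
  lincomb (fun v => a * c v + c' v) = a *: lincomb c + lincomb c'.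
Proof.
move=> /finite_fsuppP [s1 _ s1P] /finite_fsuppP [s2 _ s2P].
pose s := undup (s1 ++ s2).
have us : uniq s by apply: undup_uniq.
have cs : fsupp c `<=` [set` s].
  by move=> v /s1P /=; rewrite mem_undup mem_cat => ->.
have c's : fsupp c' `<=` [set` s].
  by move=> v /s2P /=; rewrite mem_undup mem_cat orbC => ->.
rewrite !(lincombE us) //; last by move=> v /fsuppD[/cs|/c's].
rewrite scaler_sumr -big_split /=.
by apply: eq_bigr => v _; rewrite scalerDl scalerA.
Qed.

Lemma fsupp_delta x : fsupp (fun v => (v == x)%:R) `<=` [set x].
Proof.
move=> v; rewrite /fsupp /=.
by case: (eqVneq v x) => [->|_] //; rewrite mulr0n eqxx.
Qed.

Lemma finite_fsupp_delta x : finite_set (fsupp (fun v => (v == x)%:R)).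
Proof. exact: sub_finite_set (@fsupp_delta x) (finite_set1 x). Qed.

Lemma lincomb_delta x : lincomb (fun v => (v == x)%:R) = x.
Proof.
rewrite (@lincombE [:: x]) // => [|v /fsupp_delta -> /=]; last exact: mem_head.
by rewrite big_seq1 eqxx scale1r.
Qed.

Definition lin_free B : Prop := forall c,
  finite_set (fsupp c) -> fsupp c `<=` B -> lincomb c = 0 -> forall v, c v = 0.

Definition spanned_by B x : Prop :=
  exists2 c, finite_set (fsupp c) & fsupp c `<=` B /\ lincomb c = x.

(** A dependency relation involves finitely many vectors, so one in the union of
a chain already lives in a member: this makes Zorn's lemma apply to the free
sets. *)
Lemma finite_sub_chain (T : choiceType) (C : set (set T)) (s : seq T) :
    total_on C subset -> C !=set0 -> [set` s] `<=` \bigcup_(X in C) X ->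
  exists2 X, C X & [set` s] `<=` X.
Proof.
move=> totC [X0 CX0]; elim: s => [|x s IHs] xsC; first by exists X0.
have [|X CX sX] := IHs.
  by move=> y ys; apply: xsC; rewrite /= inE (ys : y \in s) orbT.
have [|Y CY Yx] := xsC x; first exact: mem_head.
have [XY|YX] := totC _ _ CX CY.
  exists Y => // y /=; rewrite inE => /predU1P[->//|ys]; exact/XY/sX.
by exists X => // y /=; rewrite inE => /predU1P[->|ys]; [apply: YX | apply: sX].
Qed.

(** A relation in which [x] has a nonzero coefficient can be solved for [x]. *)
Lemma lin_free_extend B x : lin_free B -> ~ spanned_by B x -> lin_free (x |` B).
Proof.
move=> freeB nspan c fc cxB c0.
have [cx0|cx_neq0] := eqVneq (c x) 0.
  apply: freeB => // v cv; have [vx|//] := cxB v cv.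
  by move: cv; rewrite /fsupp /= vx cx0 eqxx.
exfalso; apply: nspan.
(* Subtracting the multiple of the relation that has coefficient 1 at [x]
   cancels the coefficient at [x] and keeps the value [x]. *)
exists (fun v => - (c x)^-1 * c v + (v == x)%:R).
  exact: finite_fsuppD (finite_fsupp_delta x).
split; last first.
  by rewrite lincombD ?c0 ?scaler0 ?add0r ?lincomb_delta //; apply: finite_fsupp_delta.
move=> v; rewrite /fsupp /=; have [->|vx] := eqVneq v x.
  by rewrite mulNr mulVf // addNr eqxx.
rewrite addr0 mulf_eq0 negb_or => /andP[_ /cxB[]//].
by move=> vx'; rewrite vx' eqxx in vx.
Qed.

(** A maximal free set spans, by [lin_free_extend]. *)
Lemma exists_basis : exists B, lin_free B /\ forall x, spanned_by B x.
Proof.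
have [C Cfree totC|B [freeB maxB]] := @Zorn_bigcup V lin_free.
  move=> c fc cC c0 v; apply/eqP/negPn/negP => cv.
  have [s sE] := (finite_seqP (fsupp c)).1 fc.
  have [X CX _] := cC v cv.
  have [||Y CY sY] := @finite_sub_chain _ C s totC; first by exists X.
    by rewrite -sE.
  by move/negP: cv; apply; apply/eqP/(Cfree Y CY) => //; rewrite sE.
exists B; split=> // x; apply: contrapT => nspan.
apply: (maxB (x |` B)); last exact: lin_free_extend.
split; first by move=> v; right.
move=> /(_ x (or_introl erefl)) Bx; apply: nspan.
exists (fun v => (v == x)%:R); first exact: finite_fsupp_delta.
by split; [move=> v /fsupp_delta -> | apply: lincomb_delta].
Qed.

(** The coordinates in a basis are unique, hence additive, and every finitely
supported family is the family of coordinates of its linear combination. *)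
Lemma exists_coordinates : exists (I : Type) (f : V -> I -> F),
  [/\ injective f,
      forall x y i, f (x + y) i = f x i + f y i &
      range f = [set u | finite_set [set i | u i != 0]]].
Proof.
have [B [freeB spanB]] := exists_basis.
pose coord x := projT1 (cid2 (spanB x)).
have coordP x : [/\ finite_set (fsupp (coord x)), fsupp (coord x) `<=` B
    & lincomb (coord x) = x].
  by rewrite /coord; case: cid2 => c /= fc [].
have coord_uniq c x : finite_set (fsupp c) -> fsupp c `<=` B -> lincomb c = x ->
    coord x =1 c.
  move=> fc cB cx v; have [fx xB xE] := coordP x; apply/eqP.
  rewrite -subr_eq0 -mulN1r addrC; apply/eqP.
  apply: (freeB (fun v => -1 * c v + coord x v)) => [||].
  - exact: finite_fsuppD.
  - by move=> w /fsuppD[/cB|/xB].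
  - by rewrite lincombD // cx xE scaleN1r addNr.
exists B, (fun x b => coord x (val b)); split.
- move=> x y /funeqP xy; have [_ xB <-] := coordP x; have [_ yB <-] := coordP y.
  congr lincomb; apply/funext => v; have [vB|nvB] := pselect (B v).
    exact: (xy (SigSub (mem_set vB))).
  rewrite [RHS](_ : _ = 0); last first.
    by apply/eqP/negPn/negP => /yB.
  by apply/eqP/negPn/negP => /xB.
- move=> x y b; have [fx xB xE] := coordP x; have [fy yB yE] := coordP y.
  rewrite (coord_uniq (fun v => 1 * coord x v + coord y v)) ?mul1r //.
  + exact: finite_fsuppD.
  + by move=> w /fsuppD[/xB|/yB].
  + by rewrite lincombD // scale1r xE yE.
apply/seteqP; split=> [_ [x _ <-]|u fu] /=.
  have [fx _ _] := coordP x.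
  apply: (@finite_preimage _ _ (fsupp (coord x)) (fun b : B => val b)) => //.
  by move=> b b' _ _; apply: val_inj.
(* Extend the family [u], indexed by the basis, by zero to all vectors. *)
pose c v := if insub v is Some b then u b else 0.
have cE b : c (val b) = u b by rewrite /c valK.
have csub : fsupp c `<=` [set val b | b in [set i | u i != 0]].
  move=> v; rewrite /fsupp /c /=; case: insubP => [b _ <- ub|_]; last by rewrite eqxx.
  by exists b.
exists (lincomb c) => //; apply/funext => b; rewrite -cE; apply: coord_uniq => //.
  exact: sub_finite_set csub (finite_image _ fu).
by move=> v /csub [w _ <-]; apply: set_valP.
Qed.
End Basis.

(** * Abelian groups of prime exponent *)

Section ElementaryAbelian.
Variables (p : nat) (G : groupType).
Hypotheses (p_pr : prime p) (mulC : forall x y : G, (x * y = y * x)%g).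
Hypothesis expp : forall x : G, (x ^+ p = 1)%g.

(** A copy of [G], so that the additive notation and the scalars of ['F_p] do not
interfere with the multiplicative structure of [G]. *)
Definition Fp_space : Type := G.
HB.instance Definition _ := Choice.on Fp_space.
HB.instance Definition _ := GRing.isZmodule.Build Fp_space
  (@mulgA G) mulC (@mul1g G) (@mulVg G).

Let scale (a : 'F_p) (x : Fp_space) : Fp_space := (x ^+ a : G)%g.

Let scale_mod (x : G) n : (x ^+ (n %% (Zp_trunc (pdiv p)).+2) = x ^+ n)%g.
Proof.
by rewrite Fp_cast // {2}(divn_eq n p) expgnDr mulnC expgnA expp expg1n mul1g.
Qed.

Fact Fp_scaleA (a b : 'F_p) x : scale a (scale b x) = scale (a * b) x.
Proof. by rewrite /scale /= scale_mod mulnC expgnA. Qed.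

Fact Fp_scale1 : left_id 1 scale.
Proof. by []. Qed.

Fact Fp_scaleDr : right_distributive scale +%R.
Proof. by move=> a x y; apply: (@expgMn G); apply: mulC. Qed.

Fact Fp_scaleDl x : {morph scale^~ x : a b / a + b}.
Proof. by move=> a b; rewrite /scale /= scale_mod expgnDr. Qed.

HB.instance Definition _ := GRing.Zmodule_isLmodule.Build 'F_p Fp_space
  Fp_scaleA Fp_scale1 Fp_scaleDr Fp_scaleDl.

Lemma elementary_abelian_of_exponent : elementary_abelian p G.
Proof.
split=> //.
(* ['F_p] is by definition ['Z_(pdiv p)], but only provably ['Z_p]. *)
have : exists (I : Type) (f : G -> I -> 'Z_(pdiv p)),
    [/\ injective f,
        forall x y i, f (x * y)%g i = f x i + f y i &
        range f = [set u | finite_set [set i | u i != 0]]].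
  exact: (@exists_coordinates 'F_p Fp_space).
by rewrite pdiv_id.
Qed.
End ElementaryAbelian.

(** * Commensurability and integer multiples *)

Section Commensurability.
Variable V : zmodType.
Implicit Types M N : set V.

Lemma is_subgroupMz N x (a : int) : is_subgroup N -> N x -> N (x *~ a).
Proof.
move=> sN Nx.
have Nn n : N (x *+ n).
  by elim: n => [|n IHn]; [exact: sN.1 | rewrite mulrS; apply: is_subgroupD].
by case: a => n; [|rewrite NegzE mulrNz; apply: is_subgroupN => //]; apply: Nn.
Qed.

Lemma is_subgroup_sum N (I : finType) (g : I -> V) : is_subgroup N ->
  (forall i, N (g i)) -> N (\sum_i g i).
Proof.
by move=> sN Ng; apply: big_ind => //; [exact: sN.1 | move=> x y; apply: is_subgroupD].
Qed.

(** If there are [m] cosets, two of the [m + 1] multiples [0, x, ..., m x] lie in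
the same one, so [N] contains [q x] for some positive [q <= m]; then [m!] serves
for all [x] at once. *)
Lemma finite_index_exponent M N : is_subgroup M -> is_subgroup N ->
  finite_index N M -> exists2 k, (0 < k)%N & forall x, M x -> N (x *+ k).
Proof.
move=> sM sN /finite_indexP-/(_ sN) [s sP].
exists (size s)`!; first exact: fact_gt0.
move=> x Mx.
have Mn n : M (x *+ n) by rewrite pmulrn; apply: is_subgroupMz.
pose r n := xget 0 [set y | y \in s /\ N (x *+ n - y)].
have rP n : r n \in s /\ N (x *+ n - r n).
  have [y ys Ny] := sP _ (Mn n).
  exact: (@xgetI _ _ [set y | y \in s /\ N (x *+ n - y)] y).
pose f (n : 'I_(size s).+1) : 'I_(size s) := Ordinal (etrans (index_mem _ _) (rP n).1).
have [i [j [ltij fij]]] : exists i j : 'I_(size s).+1, (i < j)%N /\ f i = f j.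
  have : ~ injective f by move=> /leq_card; rewrite !card_ord ltnn.
  apply: contra_notP => ninj i j fij; apply/val_inj/eqP; rewrite eqn_leq.
  by apply/andP; split; rewrite leqNgt; apply/negP => lt; apply: ninj;
     [exists j, i | exists i, j].
have rij : r i = r j.
  by apply: (@index_inj _ 0 s _ _ (rP i).1 (rP j).1); apply: (congr1 val fij).
have Nij : N (x *+ (j - i)).
  rewrite mulrnBr ?(ltnW ltij) //.
  have := sN.2 _ _ (rP j).2 (rP i).2.
  by rewrite rij opprB addrA subrK.
have /dvdnP[q ->] : (j - i %| (size s)`!)%N.
  rewrite dvdn_fact // subn_gt0 ltij /=.
  by rewrite (leq_trans (leq_subr _ _)) // -ltnS.
by rewrite mulnC mulrnA pmulrn; apply: is_subgroupMz.
Qed.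

Definition finitely_generated M : Prop :=
  exists (I : finType) (g : I -> V), (forall i, M (g i)) /\
    forall x, M x -> exists a : I -> int, x = \sum_i g i *~ a i.

(** Dividing the integer coefficients by [k] leaves finitely many combinations of
the generators,
with coefficients among 0, ..., k - 1, as representatives modulo [N]. *)
Lemma finite_index_multiples M N k : is_subgroup N -> finitely_generated M ->
  (0 < k)%N -> (forall x, M x -> N (x *+ k)) -> finite_index N M.
Proof.
case: k => // k sN [I [g [Mg gP]]] _ kMN; apply/finite_indexP => //.
exists [seq \sum_i g i *+ r i | r : {ffun I -> 'I_k.+1}] => x /gP[a ->].
pose r := [ffun i => inord `|(a i %% k.+1%:Z)%Z|%N : 'I_k.+1].
exists (\sum_i g i *+ r i); first by apply/fintype.imageP; exists r.
rewrite -sumrB.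
rewrite (eq_bigr (fun i => g i *+ k.+1 *~ (a i %/ k.+1%:Z)%Z)) => [|i _].
  by apply: is_subgroup_sum => // i; apply: is_subgroupMz => //; apply: kMN.
have am0 : 0 <= (a i %% k.+1%:Z)%Z by apply: modz_ge0.
rewrite ffunE inordK; last first.
  by rewrite -ltz_nat gez0_abs // ltz_pmod.
rewrite pmulrn gez0_abs // {1}(divz_eq (a i) k.+1%:Z) mulrzDr addrK.
by rewrite mulrC mulrzA pmulrn.
Qed.

Lemma commensurate_multiples M N k l : is_subgroup M -> is_subgroup N ->
    finitely_generated M -> finitely_generated N -> (0 < k)%N -> (0 < l)%N ->
    (forall x, M x -> N (x *+ k)) -> (forall x, N x -> M (x *+ l)) ->
  commensurate M N.
Proof.
move=> sM sN fM fN k0 l0 MN NM; have sMN := is_subgroupI sM sN.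
split; [apply: (finite_index_multiples sMN fM k0)
      | apply: (finite_index_multiples sMN fN l0)].
  by move=> x Mx; split; [rewrite pmulrn; apply: is_subgroupMz | apply: MN].
by move=> x Nx; split; [apply: NM | rewrite pmulrn; apply: is_subgroupMz].
Qed.
End Commensurability.

Lemma finitely_generated_mximage (R : comUnitRingType) d (A : 'M[R]_d) M :
  finitely_generated M -> finitely_generated (mximage A M).
Proof.
move=> [I [g [Mg gP]]]; exists I, (fun i => A *m g i); split=> [i|_ [x Mx <-]].
  by exists (g i).
have [a ->] := gP x Mx; exists a; rewrite mulmx_sumr; apply: eq_bigr => i _.
by rewrite -[in LHS]scaler_int -scalemxAr scaler_int.
Qed.

(** * Similarities of a free module over a subring of the reals *)

Section Lattice.
Variables (R : realType) (d : nat) (S : subringClosed R) (Gamma : zmodClosed 'cV[R]_d).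
Hypothesis fgS : finitely_generated_Zmodule S.
Hypothesis freeG : spanning_free_module S Gamma.

Local Notation Gam := [set` Gamma].
Let sG : is_subgroup Gam := is_subgroup_zmodClosed Gamma.

Lemma lattice_matrix : exists2 P : 'M[R]_d, P \in unitmx &
  forall v, v \in Gamma <-> exists2 c : 'cV[R]_d, c \is a mxOver S & v = P *m c.
Proof.
have [b bB GP] := freeG.
pose P : 'M[R]_d := \matrix_(i, j) (b`_j : 'cV[R]_d) i 0.
have PE (c : 'cV_d) : P *m c = \sum_(j < d) c j 0 *: b`_j.
  apply/colP => i; rewrite !mxE summxE; apply: eq_bigr => j _.
  by rewrite !mxE mulrC.
exists P.
  rewrite -unitmx_tr -row_free_unit; apply: inj_row_free => v.
  move=> /(congr1 trmx); rewrite trmx_mul trmxK trmx0 PE => v0.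
  have /freeP/(_ _ v0) k0 := basis_free bB.
  by apply/rowP => j; have := k0 j; rewrite !mxE.
move=> v; rewrite GP; split=> [[c cS ->]|[c /mxOverP cS ->]].
  exists (\col_j c j); first by apply/mxOverP => i j; rewrite mxE.
  by rewrite PE; apply: eq_bigr => j _; rewrite mxE.
by exists (fun j => c j 0).
Qed.

Lemma lattice_scale c v : c \in S -> v \in Gamma -> c *: v \in Gamma.
Proof.
have [P _ GP] := lattice_matrix.
move=> cS /GP[w /mxOverP wS ->]; apply/GP; exists (c *: w); last by rewrite scalemxAr.
by apply/mxOverP => i j; rewrite mxE rpredM.
Qed.

Lemma lattice_finitely_generated : finitely_generated Gam.
Proof.
have [n [s sS]] := fgS; have [b _ GP] := freeG.
have bG i : (b : seq _)`_(val (i : 'I_d)) \in Gamma.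
  apply/GP; exists (fun j => (j == i)%:R) => [j|].
    by case: eqP => _; rewrite ?rpred1 ?rpred0.
  rewrite (bigD1 i) //= eqxx scale1r big1 ?addr0 // => j /negPf ->.
  by rewrite scale0r.
exists ('I_d * 'I_n)%type, (fun ij : 'I_d * 'I_n => s`_(ij.2) *: b`_(ij.1)).
split=> [[i l]|v].
  rewrite /=; apply: lattice_scale; last exact: bG.
  apply/sS; exists [ffun j => (j == l)%:R].
  rewrite (bigD1 l) //= big1 ?addr0 ?ffunE ?eqxx // => j /negPf jl.
  by rewrite ffunE jl.
move=> /GP[c cS ->].
pose a i := projT1 (cid ((sS (c i)).1 (cS i))).
have aP i : c i = \sum_(l < n) s`_l *~ a i l by rewrite /a; case: cid.
exists (fun il => a il.1 il.2).
rewrite -(pair_bigA _ (fun (i : 'I_d) (l : 'I_n) => (s`_l *: b`_i) *~ a i l)) /=.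
apply: eq_bigr => i _; rewrite aP scaler_suml; apply: eq_bigr => l _.
by rewrite scalerMzl.
Qed.

(** The determinant is computed in a basis of [Gamma], where some integer
multiple of the matrix has all its entries in [S]. *)
Lemma det_commensurate (B : 'M[R]_d) : commensurate (mximage B Gam) Gam ->
  exists2 k, (0 < k)%N & \det B *+ k \in S.
Proof.
move=> [idx _]; have [P uP GP] := lattice_matrix.
have [||k k0 kP] := finite_index_exponent _ _ idx.
- exact: is_subgroup_mximage.
- exact/is_subgroupI/sG/is_subgroup_mximage.
pose N := invmx P *m B *m P.
have NS : N *+ k \is a mxOver S.
  apply/mxOverP => i j.
  pose e : 'cV[R]_d := delta_mx j 0.
  have Pe : P *m e \in Gamma.
    by apply/GP; exists e => //; apply/mxOverP => r t; rewrite mxE;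
      case: (_ && _); rewrite ?rpred0 ?rpred1.
  have BPe : mximage B Gam (B *m (P *m e)) by exists (P *m e).
  have [_ /GP[c /mxOverP cS cE]] := kP _ BPe.
  suff -> : (N *+ k) i j = c i 0 by [].
  have -> : (N *+ k) i j = (col j (N *+ k)) i 0 by rewrite [RHS]mxE.
  rewrite colE -(mulKmx uP c) -cE -!scaler_nat -scalemxAr -scalemxAl.
  by rewrite -!mulmxA.
exists (k ^ d)%N; first by rewrite expn_gt0 k0.
have -> : \det B *+ k ^ d = \det (N *+ k).
  rewrite -[N *+ k]scaler_nat detZ !det_mulmx det_inv mulrAC.
  by rewrite mulVr ?mul1r -?unitmxE // -natrX mulr_natl.
rewrite /determinant; apply: rpred_sum => s _; rewrite rpredMsign.
by apply: rpred_prod => i _; apply: (mxOverP NS).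
Qed.

(** The denominator [k] of [c] bounds one index, and that of [c^-1] the other. *)
Lemma scalar_commensurate (c : R) k l : c != 0 -> (0 < k)%N -> (0 < l)%N ->
  c *+ k \in S -> c^-1 *+ l \in S -> commensurate (mximage (c *: 1%:M) Gam) Gam.
Proof.
move=> c0 k0 l0 ck cl.
have fgG := lattice_finitely_generated.
apply: (commensurate_multiples _ _ _ _ k0 l0) => //.
- exact: is_subgroup_mximage.
- exact: finitely_generated_mximage.
- move=> _ [v Gv <-]; rewrite -scalemxAl mul1mx scalerMnl.
  exact: lattice_scale.
move=> v Gv; exists (c^-1 *+ l *: v); first exact: lattice_scale.
by rewrite -scalemxAl mul1mx scalerA mulrnAr mulfV // scaler_nat.
Qed.

(** The sign of [a] is immaterial, as [Gamma] is stable under opposite; that [a]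
is nonzero makes [a *: A] invertible. *)
Definition similarity_ratio (a : R) (A : orthogonal_group R d) : Prop :=
  a != 0 /\ commensurate (mximage (a *: val A) Gam) Gam.

Lemma ratio_unit a A : similarity_ratio a A -> a *: val A \in unitmx.
Proof.
by move=> [a0 _]; rewrite unitmxZ ?unitfE //; apply: orthogonalmx_unit (valP A).
Qed.

Lemma ratioM a b A B : similarity_ratio a A -> similarity_ratio b B ->
  similarity_ratio (a * b) (A * B)%g.
Proof.
move=> rA [b0 cB]; have [a0 cA] := rA; split; first by rewrite mulf_neq0.
rewrite -scalerA [val _]/= scalemxAr scalemxAl mximageM.
apply: commensurate_trans cA => //; try exact/is_subgroup_mximage.
  exact/is_subgroup_mximage/is_subgroup_mximage.
by apply: commensurate_mximage => //; [apply: ratio_unit | apply: is_subgroup_mximage].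
Qed.

Lemma ratioV a A : similarity_ratio a A -> similarity_ratio a^-1 (A^-1)%g.
Proof.
move=> rA; have [a0 cA] := rA; split; first by rewrite invr_eq0.
apply: commensurate_sym.
rewrite -{1}(mximage1 Gam).
have <- : (a^-1 *: val (A^-1)%g) *m (a *: val A) = 1%:M.
  rewrite -scalemxAl -scalemxAr scalerA mulVf // scale1r.
  exact/orthogonalmxP/valP.
rewrite mximageM; apply: commensurate_mximage => //; last exact: is_subgroup_mximage.
rewrite unitmxZ ?unitfE ?invr_eq0 //; exact: orthogonalmx_unit (valP A^-1%g).
Qed.

Lemma ratioX a A n : similarity_ratio a A -> similarity_ratio (a ^+ n) (A ^+ n)%g.
Proof.
move=> rA; elim: n => [|n IHn]; last by rewrite exprS expgS; apply: ratioM.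
split; first exact: oner_neq0.
by rewrite expr0 scale1r mximage1; apply: commensurate_refl.
Qed.

(** [a ^+ d] is the determinant of [a *: A] up to the sign [\det A], and [S] is
stable under sign change. *)
Lemma ratio_exp_dim a A : similarity_ratio a A -> similarity_ratio (a ^+ d) 1%g.
Proof.
move=> rA; have [a0 cA] := rA; have ad0 : a ^+ d != 0 by rewrite expf_neq0.
split=> //.
have detS b B : similarity_ratio b B -> exists2 k, (0 < k)%N & b ^+ d *+ k \in S.
  move=> [_ /det_commensurate[k k0]]; rewrite detZ => kS; exists k => //.
  have /orthogonalmxP/(congr1 determinant) := valP B.
  rewrite det_mulmx det_tr det1 -expr2 => /eqP; rewrite sqrf_eq1.
  by move: kS => /[swap] /pred2P[]->; rewrite ?mulr1 // mulrN1 mulNrn rpredN.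
have [k k0 kS] := detS _ _ rA.
have [l l0 lS] := detS _ _ (ratioV rA).
by apply: (scalar_commensurate _ k0 l0) => //; rewrite -exprVn.
Qed.
End Lattice.

(** * The quotient of the similarity group by the coincidence group *)

Theorem corollary3p16 (R : realType) (p : nat) (S : subringClosed R)
    (Gamma : zmodClosed 'cV[R]_p) :
  finitely_generated_Zmodule S ->
  spanning_free_module S Gamma ->
  prime p ->
  elementary_abelian p (OS_mod_OC Gamma).
Proof.
move=> fgS freeG p_pr.
have OSr (A : OS_group Gamma) : exists a, similarity_ratio Gamma a (val A).
  by have /OSP[a a0 cA] := valP A; exists a; split; rewrite ?gt_eqF.
have OCr (A : OS_group Gamma) : similarity_ratio Gamma 1 (val A) -> A \in OC_normal Gamma.
  by move=> [_]; rewrite scale1r => cA; apply/OCP.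
apply: elementary_abelian_of_exponent => // [x y|x].
  rewrite -(quot_reprK x) -(quot_reprK y) -!quot_piM; apply/quot_piP/OCr.
  move: (repr x) (repr y) => A B; have [a rA] := OSr A; have [b rB] := OSr B.
  have := ratioM (ratioV (ratioM rA rB)) (ratioM rB rA).
  rewrite [b * a]mulrC mulVf //.
  by case: (ratioM rA rB).
rewrite -(quot_reprK x); move: (repr x) => A.
have -> n : (quot_pi (OC_normal Gamma) A ^+ n = quot_pi (OC_normal Gamma) (A ^+ n))%g.
  by elim: n => // n IHn; rewrite !expgS IHn quot_piM.
apply/esym/quot_piP/OCr; rewrite invg1 mul1g.
have [a rA] := OSr A.
have rp := ratio_exp_dim fgS freeG rA.
have := ratioM (ratioV rp) (ratioX p rA).
rewrite mulVf; last by case: rp.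
have valX n : (val (A ^+ n) = val A ^+ n)%g.
  by elim: n => // n IHn; rewrite !expgS -IHn.
by rewrite invg1 mul1g valX.
Qed.
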